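(* Let $n$ be an odd positive integer and let $a\in\mathbb{F}_{2^n}$ be a nonzero element with $\operatorname{tr}\left(\frac{1}{a}\right)=1$. Let $P(x)=x+x^2+\operatorname{tr}\left(\frac{x}{a}\right)\in\mathbb{F}_{2^n}[x]$, which is a linearized permutation polynomial of $\mathbb{F}_{2^n}$. Then its compositional inverse is $$P^{-1}(x)=B_a(x)+\operatorname{tr}(x),\qquad B_a(x)=\sum_{i=0}^{n-1}b_ix^{2^i},$$ where, writing $c=\frac{1}{a}$, $$b_0=c\langle\{2,4,6,\ldots,n-1\}\rangle,$$ and for $1\le i\le n-1$, $$b_i=\begin{cases} c\langle\{1,3,5,\ldots,i\}\cup\{i+1,i+3,\ldots,n-1\}\rangle & \text{if } i \text{ is odd},\\ c\langle\{1,3,5,\ldots,i-1\}\cup\{i+2,i+4,\ldots,n-1\}\rangle & \text{if } i \text{ is even}.\end{cases}$$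
   Context: $\operatorname{tr}$ denotes the absolute trace of $\mathbb{F}_{2^n}$; as a polynomial, $\operatorname{tr}(x)=\sum_{i=0}^{n-1}x^{2^i}$, and $\operatorname{tr}(x/a)=\sum_{i=0}^{n-1}(x/a)^{2^i}$. For $c\in\mathbb{F}_{2^n}$ and a subset $I\subseteq\{0,1,\ldots,n-1\}$, the notation $c\langle I\rangle$ means $\sum_{i\in I}c^{2^i}$ (an empty set gives $0$); the sets listed are arithmetic progressions with step $2$, empty if the starting value exceeds the end value. The compositional inverse $P^{-1}$ is the unique polynomial of degree less than $2^n$ with $P(P^{-1}(x))\equiv P^{-1}(P(x))\equiv x \pmod{x^{2^n}-x}$. *)

(* Defs.v *)
From HB Require Import structures.
From mathcomp Require Import all_boot all_order all_algebra all_fingroup all_field.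
Set Implicit Arguments.
Unset Strict Implicit.
Unset Printing Implicit Defensive.
Import GRing.Theory.
Local Open Scope ring_scope.

(* Stated over any ring, so that it covers both the trace of an element of   *)
(* F_{2^n} and the polynomials tr(x), tr(x/a) obtained by evaluating the     *)
(* same expression at an element of {poly F}.                                *)
Definition abs_tr (n : nat) (R : nzRingType) (u : R) : R :=
  \sum_(i < n) u ^+ (2 ^ i).

(* c<I> *)
Definition angle (F : fieldType) (n : nat) (c : F) (I : {set 'I_n}) : F :=
  \sum_(i in I) c ^+ (2 ^ i).

(* {s, s+2, s+4, ..., e}, empty when s > e; only used with e < n. *)
Definition prog2 (n s e : nat) : {set 'I_n} :=
  [set j : 'I_n | (s <= j <= e)%N && ~~ odd (j - s)].

Definition b_coef (F : fieldType) (n : nat) (c : F) (i : nat) : F :=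
  if i == 0%N then angle c (prog2 n 2 n.-1)
  else if odd i then angle c (prog2 n 1 i :|: prog2 n i.+1 n.-1)
  else angle c (prog2 n 1 i.-1 :|: prog2 n i.+2 n.-1).

Definition B_poly (F : fieldType) (n : nat) (a : F) : {poly F} :=
  \sum_(i < n) b_coef n a^-1 i *: 'X^(2 ^ i).

Definition P_poly (F : fieldType) (n : nat) (a : F) : {poly F} :=
  'X + 'X^2 + abs_tr n (a^-1 *: 'X).

Definition linearized2 (F : fieldType) (L : {poly F}) : Prop :=
  exists l : seq F, L = \sum_(i < size l) l`_i *: 'X^(2 ^ i).

Definition permutation_poly (F : finFieldType) (L : {poly F}) : Prop :=
  bijective (fun x : F => L.[x]).

(* size = degree + 1, so the first clause says that Q has degree < #|F|. *)
Definition is_comp_inverse (F : finFieldType) (L Q : {poly F}) : Prop :=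
  [/\ (size Q <= #|F|)%N,
      ('X^#|F| - 'X) %| (L \Po Q - 'X)
    & ('X^#|F| - 'X) %| (Q \Po L - 'X)].

(* Main.v *)
Require Import Defs.
From HB Require Import structures.
From mathcomp Require Import all_boot all_order all_algebra all_fingroup all_field.
From mathcomp Require Import zify ring.
Import GRing.Theory.
Local Open Scope ring_scope.

(* In characteristic 2 the coefficients are b_i = sum_j ([j even, j > 0] +   *)
(* [0 < j <= i]) c^(2^j).  Hence b_{i+1} - b_i = c^(2^(i+1)), while b_0 +    *)
(* b_{n-1} = tr(c) + c = 1 + c, so that B_a(x + x^2) = x + tr(c x); moreover *)
(* sum_i b_i = 0, so B_a kills the prime field.  As tr(P(x)) = tr(c x),      *)
(* this gives B_a(P(x)) + tr(P(x)) = x for every x, and a left inverse on a  *)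
(* finite set is two-sided.                                                  *)

(** The identity is checked on values. [b_coefE] encodes all three cases of [b_i] as one parity sum,
    from which [b_coefS], [b_coef0_last] and [sum_b_coef] are read off; these give
    [B_eval_artin_schreier] and [B_eval_fix], hence [B_eval_left_inverse]. Since X^|F| - X vanishes
    exactly to the extent that all values do ([dvdp_XcardBX]), and a polynomial of degree less than
    |F| is determined by its values, [unique_comp_inverse] turns this left inverse on values into
    the unique compositional inverse. *)

Section Char2.
Context {F : fieldType} (char2 : 2%N \in [pchar F]).
Implicit Types (x y c : F) (n i k : nat).

Lemma natr_pchar2 k : k%:R = (odd k)%:R :> F.
Proof. by rewrite -[LHS](GRing.natr_mod_pchar char2) modn2. Qed.

Lemma natr_addb (b1 b2 : bool) : (b1 (+) b2)%:R = b1%:R + b2%:R :> F.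
Proof. by case: b1; case: b2; rewrite /= ?addr0 ?add0r ?(addrr_pchar2 char2). Qed.

Lemma exprD_2expn i x y : (x + y) ^+ (2 ^ i) = x ^+ (2 ^ i) + y ^+ (2 ^ i).
Proof.
apply: exprDn_pchar; rewrite (eq_pnat _ (pcharf_eq char2)).
by rewrite pnatX pnat_id.
Qed.

Lemma abs_trD n : {morph @abs_tr n F : x y / x + y}.
Proof.
by move=> x y; rewrite -big_split; apply: eq_bigr => i _; rewrite exprD_2expn.
Qed.

(** Squaring shifts the conjugates of [x] cyclically. *)
Lemma abs_tr_sqr n x : x ^+ (2 ^ n) = x -> abs_tr n (x ^+ 2) = abs_tr n x.
Proof.
case: n => [|m] hx; first by rewrite /abs_tr !big_ord0.
rewrite /abs_tr big_ord_recr big_ord_recl /= -exprM -expnS hx addrC.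
by congr (_ + _); apply: eq_bigr => i _; rewrite -exprM -expnS.
Qed.

Lemma sqr_abs_tr n x : abs_tr n x ^+ 2 = abs_tr n (x ^+ 2).
Proof.
rewrite /abs_tr; elim: n => [|n IHn]; first by rewrite !big_ord0 expr0n.
by rewrite !big_ord_recr /= -IHn (exprD_2expn 1) -!exprM mulnC.
Qed.

Lemma abs_tr_idem n x i : x ^+ (2 ^ n) = x ->
  abs_tr n x ^+ (2 ^ i) = abs_tr n x.
Proof.
move=> hx; elim: i => [|i IHi]; first by rewrite expn0 expr1.
by rewrite expnS exprM sqr_abs_tr abs_tr_sqr.
Qed.

(** Each index set is the symmetric difference of the positive even numbers and {1, ..., i}; in
    characteristic 2 the exclusive or becomes a sum of coefficients. *)
Lemma b_coefE n c i : odd n -> (i < n)%N ->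
  b_coef n c i =
  \sum_(j < n) ((0 < j)%N && ~~ odd j (+) (0 < j <= i)%N)%:R * c ^+ (2 ^ j).
Proof.
move=> hn ltin.
have -> : b_coef n c i =
    \sum_(j < n | ((0 < j)%N && ~~ odd j) (+) (0 < j <= i)%N) c ^+ (2 ^ j).
  rewrite /b_coef /angle.
  case: ifPn => [/eqP i0|i0]; last case: ifPn => oi; apply: eq_bigl => j;
    rewrite ?inE; have := ltn_ord j; lia.
rewrite big_mkcond; apply: eq_bigr => j _.
by case: (_ (+) _); rewrite ?mul1r ?mul0r.
Qed.

(** Passing from {1, ..., i} to {1, ..., i+1} changes membership of the index i+1 only. *)
Lemma b_coefS n c i : odd n -> (i.+1 < n)%N ->
  b_coef n c i.+1 + b_coef n c i = c ^+ (2 ^ i.+1).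
Proof.
move=> hn ltin; rewrite !b_coefE ?(ltnW ltin) // -big_split /=.
rewrite (bigD1 (Ordinal ltin)) //= big1 => [|j neq_j]; last first.
  have -> : (0 < j <= i.+1)%N = (0 < j <= i)%N.
    by have : nat_of_ord j != i.+1 := neq_j; lia.
  exact: addrr_pchar2.
rewrite ltnSn ltnn addr0 -mulrDl -natr_addb.
by case: odd; rewrite mul1r.
Qed.

(** The contributions of the even indices cancel, leaving all c^(2^j) with 0 < j < n. *)
Lemma b_coef0_last n c : odd n ->
  b_coef n c 0 + b_coef n c n.-1 = abs_tr n c + c.
Proof.
case: n => // m hn; rewrite !b_coefE // -big_split /= /abs_tr !big_ord_recl /=.
rewrite !mul0r !add0r expn0 expr1 addrAC (addrr_pchar2 char2) add0r.
apply: eq_bigr => j _; rewrite -mulrDl -natr_addb /bump /= add1n ltn_ord.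
by case: odd; rewrite mul1r.
Qed.

Lemma sum_leq_ord n k : (\sum_(i < n) (k <= i) = n - k)%N.
Proof.
elim: n => [|n IHn]; first by rewrite big_ord0.
by rewrite big_ord_recr /= IHn; lia.
Qed.

(** For j > 0 the power c^(2^j) is counted n - j times, plus n more times if j is even; as n is odd,
    the total is even. *)
Lemma sum_b_coef n c : odd n -> \sum_(i < n) b_coef n c i = 0.
Proof.
move=> hn; under eq_bigr => i _ do rewrite b_coefE //.
rewrite exchange_big big1 //= => j _; rewrite -mulr_suml.
under eq_bigr => i _ do rewrite natr_addb.
rewrite big_split /= sumr_const card_ord -mulrnA -natr_sum.
case: (posnP j) => [->|j_gt0]; first by rewrite big1 // addr0 mul0r.
rewrite (eq_bigr (fun i : 'I_n => (j <= i)%N : nat)) //.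
rewrite sum_leq_ord -natrD natr_pchar2.
have -> : odd (~~ odd j * n + (n - j)) = false by have := ltn_ord j; lia.
by rewrite mul0r.
Qed.

Definition B_eval n c x := \sum_(i < n) b_coef n c i * x ^+ (2 ^ i).

Lemma B_evalD n c : {morph B_eval n c : x y / x + y}.
Proof.
move=> x y; rewrite -big_split; apply: eq_bigr => i _.
by rewrite exprD_2expn mulrDr.
Qed.

Lemma B_eval_fix n c x : odd n -> (forall i, x ^+ (2 ^ i) = x) ->
  B_eval n c x = 0.
Proof.
move=> hn hx; rewrite /B_eval; under eq_bigr => i _ do rewrite hx.
by rewrite -mulr_suml sum_b_coef // mul0r.
Qed.

Lemma B_eval_artin_schreier n c x : odd n -> abs_tr n c = 1 ->
  x ^+ (2 ^ n) = x -> B_eval n c (x + x ^+ 2) = x + abs_tr n (c * x).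
Proof.
move=> hn hc hx; have := b_coef0_last n c hn; rewrite hc B_evalD /B_eval.
case: n hn hx {hc} => // m hn hx /= hb.
rewrite big_ord_recl big_ord_recr /= -exprM -expnS hx /abs_tr big_ord_recl /=.
rewrite expn0 !expr1.
(* At x^(2^(i+1)) the coefficients b_(i+1) and b_i meet; the last term of the sum in x^2 wraps
   around to x^(2^n) = x and meets b_0. *)
rewrite (_ : \sum_(i < m) (c * x) ^+ _ =
    \sum_(i < m) b_coef m.+1 c (bump 0 i) * x ^+ (2 ^ bump 0 i) +
    \sum_(i < m) b_coef m.+1 c i * (x ^+ 2) ^+ (2 ^ i)); last first.
  rewrite -big_split; apply: eq_bigr => i _ /=.
  by rewrite -exprM -expnS -mulrDl b_coefS ?ltnS // exprMn.
have hx1 : x + c * x = (b_coef m.+1 c 0 + b_coef m.+1 c m) * x.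
  by rewrite hb mulrDl mul1r.
by rewrite [RHS]addrA hx1; ring.
Qed.

Lemma B_eval_left_inverse n c x (t := abs_tr n (c * x)) :
  odd n -> abs_tr n c = 1 -> c ^+ (2 ^ n) = c -> x ^+ (2 ^ n) = x ->
  B_eval n c (x + x ^+ 2 + t) + abs_tr n (x + x ^+ 2 + t) = x.
Proof.
move=> hn hc cfix xfix.
have tfix i : t ^+ (2 ^ i) = t by rewrite abs_tr_idem // exprMn cfix xfix.
rewrite B_evalD B_eval_artin_schreier // B_eval_fix // !abs_trD.
rewrite abs_tr_sqr // (addrr_pchar2 char2) add0r addr0.
(* [t] lies in the prime field, so its trace is n t, and n is odd. *)
have -> : abs_tr n t = t.
  rewrite /abs_tr; under eq_bigr => i _ do rewrite tfix.
  by rewrite sumr_const card_ord -mulr_natr natr_pchar2 hn mulr1.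
by rewrite -addrA (addrr_pchar2 char2) addr0.
Qed.

End Char2.

Lemma horner_abs_tr (F : fieldType) n (p : {poly F}) x :
  (abs_tr n p).[x] = abs_tr n p.[x].
Proof. by rewrite horner_sum; apply: eq_bigr => i _; rewrite horner_exp. Qed.

Lemma horner_B_poly (F : fieldType) n (a x : F) :
  (B_poly n a).[x] = B_eval n a^-1 x.
Proof.
by rewrite horner_sum; apply: eq_bigr => i _; rewrite hornerZ hornerXn.
Qed.

Lemma horner_P_poly (F : fieldType) n (a x : F) :
  (P_poly n a).[x] = x + x ^+ 2 + abs_tr n (a^-1 * x).
Proof.
by rewrite /P_poly !hornerD horner_abs_tr hornerZ hornerXn hornerX.
Qed.

Lemma P_poly_linearized (F : fieldType) n (a : F) :
  (0 < n)%N -> linearized2 (P_poly n a).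
Proof.
case: n => // m _.
pose l i : F :=
  (i == 0)%:R + (i == 1)%:R + (if (i < m.+1)%N then a^-1 ^+ (2 ^ i) else 0).
(* One entry more than n, so that X^2 has an index even when n = 1. *)
exists (mkseq l m.+2); rewrite size_mkseq.
under eq_bigr => i _ do rewrite nth_mkseq // /l !scalerDl.
rewrite !big_split /=; congr (_ + _ + _).
- rewrite big_ord_recl big1 => [|i _]; last by rewrite scale0r.
  by rewrite scale1r addr0.
- rewrite big_ord_recl big_ord_recl big1 => [|i _]; last by rewrite scale0r.
  by rewrite scale1r scale0r addr0 add0r.
rewrite big_ord_recr /= ltnn scale0r addr0; apply: eq_bigr => i _.
by rewrite ltn_ord exprZn.
Qed.

Lemma size_inverse_poly (F : fieldType) n (a : F) :
  (size (B_poly n a + abs_tr n 'X)%R <= 2 ^ n)%N.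
Proof.
rewrite (leq_trans (size_polyD _ _)) // geq_max; apply/andP; split;
  apply: (leq_trans (size_sum _ _ _)); apply/bigmax_leqP => i _.
  by rewrite (leq_trans (size_scale_leq _ _)) // size_polyXn ltn_exp2l.
by rewrite size_polyXn ltn_exp2l.
Qed.

Section FinField.
Context {F : finFieldType}.
Implicit Types p q : {poly F}.

(** X^|F| - X is the product of X - x over all x in F. *)
Lemma dvdp_XcardBX p : ('X^#|F| - 'X %| p) <-> (forall x, p.[x] = 0).
Proof.
split=> [/dvdpP[q ->] x | p0].
  by rewrite hornerM !hornerE expf_card subrr mulr0.
rewrite finField_genPoly -big_enum; apply: uniq_roots_dvdp.
  by apply/allP => x _; apply/rootP.
by rewrite uniq_rootsE enum_uniq.
Qed.

Lemma poly_fun_inj p q : (size p <= #|F|)%N -> (size q <= #|F|)%N ->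
  (forall x, p.[x] = q.[x]) -> p = q.
Proof.
move=> sp sq pq; apply/eqP; rewrite -subr_eq0; apply/eqP.
apply: (@roots_geq_poly_eq0 _ _ (enum F)); rewrite ?enum_uniq //.
  by apply/allP => x _; rewrite /root !hornerE pq subrr.
by rewrite -cardE (leq_trans (size_polyD _ _)) // size_polyN geq_max sp.
Qed.

Lemma is_comp_inverseP p q :
  is_comp_inverse p q <->
  [/\ (size q <= #|F|)%N, cancel (horner q) (horner p)
    & cancel (horner p) (horner q)].
Proof.
have comp (r s : {poly F}) : ('X^#|F| - 'X %| r \Po s - 'X) <-> cancel (horner s) (horner r).
  have evalE x : (r \Po s - 'X).[x] = r.[s.[x]] - x.
    by rewrite !hornerE horner_comp.
  split=> [/dvdp_XcardBX rs x | rs]; last first.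
    by apply/dvdp_XcardBX => x; rewrite evalE rs subrr.
  by apply/eqP; rewrite -subr_eq0 -evalE rs.
by split=> -[sq /comp pq /comp qp].
Qed.

Lemma unique_comp_inverse p q : (size q <= #|F|)%N ->
  cancel (horner p) (horner q) ->
  bijective (horner p) /\ unique (is_comp_inverse p) q.
Proof.
move=> sq qp.
have bij_p : bijective (horner p) by apply/injF_bij/(can_inj qp).
have pq : cancel (horner q) (horner p) by apply/(bij_can_sym bij_p).
split=> //; split; first exact/is_comp_inverseP.
move=> q' /is_comp_inverseP [sq' _ q'p]; apply: poly_fun_inj => // x.
(* q'(x) = q'(p(q(x))) = q(x). *)
by rewrite -{2}(pq x) q'p.
Qed.

End FinField.

Theorem theorem2 (n : nat) (F : finFieldType) (a : F)
  (hn : odd n) (hF : #|F| = (2 ^ n)%N)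
  (ha : a != 0) (htr : abs_tr n (1 / a) = 1) :
  [/\ linearized2 (P_poly n a),
      permutation_poly (P_poly n a)
    & unique (is_comp_inverse (P_poly n a)) (B_poly n a + abs_tr n 'X)].
Proof.
have char2 : 2%N \in [pchar F] by apply: card_finPcharP hF _.
have frob (x : F) : x ^+ (2 ^ n) = x by rewrite -hF expf_card.
have [|x|bij_P uniq_Q] :=
    @unique_comp_inverse F (P_poly n a) (B_poly n a + abs_tr n 'X).
- by rewrite hF size_inverse_poly.
- rewrite hornerD horner_B_poly horner_abs_tr hornerX horner_P_poly.
  by apply: B_eval_left_inverse; rewrite // -div1r.
- by split=> //; apply: P_poly_linearized; case: (n) hn.
Qed.
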